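(* For all constants $a,b>0$ there is a constant $c>0$, depending only on $a$ and $b$, with the following property. Let $n\geq 2$, let $1\leq v\leq\sqrt n$, and let $Q,U\subset\mathbb{R}^n$ be origin-symmetric convex bodies. Suppose that there are even continuous probability densities $p,h$ on $\mathbb{R}^n$ such that \[ \operatorname{supp}p\subset Q\setminus U,\qquad \int_{\xi^\perp}p\,d\lambda_{\xi^\perp}\leq\frac{a}{\sqrt n}\quad\text{for all }\xi\in\mathbb{S}^{n-1}, \] \[ \operatorname{supp}h\subset U\setminus Q,\qquad \int_{\xi^\perp}h\,d\lambda_{\xi^\perp}\geq\frac{b}{v}\quad\text{for all }\xi\in\mathbb{S}^{n-1}. \] Then there is an even, continuous, strictly positive, integrable density $f$ on $\mathbb{R}^n$ such that \[ \mu_f(Q\cap\xi^\perp)<\mu_f(U\cap\xi^\perp)\qquad\text{for all }\xi\in\mathbb{S}^{n-1} \] and \[ \frac{\mu_f(Q)}{\mu_f(U)}\geq c\,\frac{\sqrt n}{v}. \]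
   Context: A convex body is a compact convex set with nonempty interior. $\mathbb{S}^{n-1}$ is the Euclidean unit sphere of $\mathbb{R}^n$, $\xi^\perp=\{x\in\mathbb{R}^n:\langle x,\xi\rangle=0\}$, and $\lambda_{\xi^\perp}$ is $(n-1)$-dimensional Lebesgue measure on $\xi^\perp$. $\operatorname{supp}p$ is the closure of $\{x:p(x)\ne0\}$. A probability density is a nonnegative function on $\mathbb{R}^n$ with Lebesgue integral $1$. For a continuous nonnegative $f$, $\mu_f(A)=\int_Af(x)\,dx$ and $\mu_f(A\cap\xi^\perp)=\int_{A\cap\xi^\perp}f\,d\lambda_{\xi^\perp}$. *)

(* Defs.v *)
From HB Require Import structures.
From mathcomp Require Import all_boot all_order all_algebra.
From mathcomp Require Import all_classical all_reals all_analysis.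
From mathcomp Require Import measurable_realfun ring.

Set Implicit Arguments.
Unset Strict Implicit.
Unset Printing Implicit Defensive.

Import Order.TTheory GRing.Theory Num.Theory.
Import numFieldNormedType.Exports.

Local Open Scope classical_set_scope.
Local Open Scope ring_scope.

(* R^n is the type 'rV[R]_n of row vectors, with its Borel sigma-algebra.
   The library norm on 'rV[R]_n is the sup norm: it is used only through the
   topology, which is the Euclidean one. *)
HB.instance Definition _ (R : realType) (n : nat) :=
  @isMeasurable.Build (sigma_display (@open 'rV[R]_n)) 'rV[R]_n
    <<s @open 'rV[R]_n >> (@sigma_algebra0 _ setT _) (@sigma_algebraC _ _)
    (@sigma_algebra_bigcup _ setT _).

Section borel_rV.
Context {R : realType}.

(* an open set is a countable union of boxes with rational data *)
Lemma measurable_fun_rV d (T : measurableType d) n (f : T -> 'rV[R]_n) :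
  (forall i, measurable_fun setT (fun t => f t ord0 i)) ->
  measurable_fun setT f.
Proof.
move=> mf; apply: (measurability (@open 'rV[R]_n)) => //.
move=> _ [A oA <-]; rewrite setTI.
pose box (qk : 'rV[rat]_n * nat) : set 'rV[R]_n :=
  [set x | forall i, `|ratr (qk.1 ord0 i) - x ord0 i| < qk.2.+1%:R^-1].
pose F qk : set T := if `[< box qk `<=` A >] then f @^-1` box qk else set0.
rewrite (_ : f @^-1` A = \bigcup_qk F qk); last first.
  apply/seteqP; split=> [t At|t [qk _]]; last first.
    by rewrite /F; case: asboolP => // sub /sub.
  have [e /= e0 eA] : exists2 e : R, 0 < e & ball (f t) e `<=` A.
    by apply/nbhs_ballP; exact: open_nbhs_nbhs.
  have [k ke] : exists k : nat, k.+1%:R^-1 < e / 2.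
    by have [k] := ltr_add_invr (divr_gt0 e0 (ltr0n R 2)); rewrite add0r => ?;
      exists k.
  pose r : R := k.+1%:R^-1.
  have r0 : 0 < r by rewrite invr_gt0.
  have /choice[q hq] : forall i, exists q : rat, `|ratr q - f t ord0 i| < r.
    move=> i.
    have /rat_in_itvoo[q] : f t ord0 i - r < f t ord0 i + r.
      by rewrite ltrD2l gtrN.
    by rewrite in_itv/= => ?; exists q; rewrite ltr_distl.
  exists (\row_i q i, k) => //; rewrite /F; case: asboolP => [_ i|].
    by rewrite /= mxE; exact: hq.
  case=> x; rewrite /box/= => hx; apply: eA; split => // i j.
  rewrite (ord1 i) /ball/=; have := hx j; rewrite mxE => hxj.
  rewrite (_ : _ - _ = - (ratr (q j) - f t ord0 j) + (ratr (q j) - x ord0 j));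
    last by rewrite opprB addrA subrK.
  rewrite (le_lt_trans (ler_normD _ _))// normrN [e]splitr ltrD//.
    exact: lt_trans (hq j) ke.
  exact: lt_trans hxj ke.
apply: countable_bigcupT_measurable => [|qk]; first exact: countableP.
rewrite /F; case: asboolP => // _.
rewrite (_ : _ @^-1` _ = \bigcap_(i in [set: 'I_n])
   [set t | `|ratr (qk.1 ord0 i) - f t ord0 i| < qk.2.+1%:R^-1]); last first.
  by apply/seteqP; split=> [t ht i _|t ht i]; exact: ht.
apply: fin_bigcap_measurable => // i _; rewrite -[X in measurable X]setTI.
rewrite (_ : [set t | _] = (fun t => `|ratr (qk.1 ord0 i) - f t ord0 i|) @^-1`
   [set` `]-oo, qk.2.+1%:R^-1[]); last first.
  by apply/seteqP; split=> t; rewrite /= in_itv.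
have mg : measurable_fun setT (fun t => `|ratr (qk.1 ord0 i) - f t ord0 i|).
  by apply: measurableT_comp => //; exact: measurable_funB.
exact: mg.
Qed.

Lemma continuous_measurable_rV n (f : 'rV[R]_n -> R) :
  continuous f -> measurable_fun setT f.
Proof.
move=> /continuousP cf; apply: (measurability _ (RGenOpens.measurableE R)).
move=> _ [_ [x [y ->]] <-]; rewrite setTI; apply: sub_sigma_algebra.
exact/cf/interval_open.
Qed.

Lemma measurable_row_mx n :
  measurable_fun [set: 'rV[R]_n * measurableTypeR R]
    (fun p => row_mx (p.2 : R)%:M p.1 : 'rV[R]_n.+1).
Proof.
apply: measurable_fun_rV => i.
rewrite (_ : (fun _ => _) = fun p : 'rV[R]_n * measurableTypeR R =>
    match @fintype.split 1%N n i with inl _ => p.2 | inr j => p.1 ord0 j end).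
  case: (@fintype.split 1%N n i) => j; first exact: measurable_snd.
  have mj : measurable_fun setT (fun x : 'rV[R]_n => x ord0 j : R).
    by apply: continuous_measurable_rV; exact: coord_continuous.
  exact: (measurableT_comp mj measurable_fst).
apply/funext => p; rewrite (@mxE _ _ (1 + n)%N); case: (@fintype.split 1%N n i) => j //.
by rewrite (ord1 j) mxE eqxx mulr1n.
Qed.

Lemma measurable_mulmx m n (B : 'M[R]_(m, n)) :
  measurable_fun [set: 'rV[R]_m] (fun y => y *m B).
Proof.
apply: measurable_fun_rV => i.
rewrite (_ : (fun _ => _) = fun y : 'rV[R]_m => \sum_j y ord0 j * B j i).
  apply: measurable_sum => j; apply: measurable_funM => //.
  by apply: continuous_measurable_rV; exact: coord_continuous.
by apply/funext => y; rewrite mxE.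
Qed.

End borel_rV.

Section lebesgue.
Context {R : realType}.
Local Open Scope ereal_scope.

Definition image_measure d1 d2 (T1 : measurableType d1) (T2 : measurableType d2)
    (mu : {measure set T1 -> \bar R}) (f : T1 -> T2)
    (mf : measurable_fun setT f) : {measure set T2 -> \bar R} :=
  measure_function_pushforward__canonical__measure_function_Measure mu mf.

(* R^0 is a point of mass 1, and Lebesgue measure on R^(n+1) is the product
   measure of Lebesgue measure on R^n and Lebesgue measure on R. *)
Fixpoint lebesgue_rV (n : nat) : {measure set 'rV[R]_n -> \bar R} :=
  match n with
  | 0%N => \d_(0%R : 'rV[R]_0)
  | m.+1 => image_measure (lebesgue_rV m \x @lebesgue_measure R)
              (@measurable_row_mx R m)
  end.

End lebesgue.

Section hyperplane.
Context {R : realType} {n : nat}.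
Implicit Types x y xi : 'rV[R]_n.

Definition dotprod x y : R := (x *m y^T) ord0 ord0.

Definition sphere : set 'rV[R]_n := [set xi | dotprod xi xi = 1].

Definition orth xi : set 'rV[R]_n := [set x | dotprod x xi = 0].

(* B is a frame of the hyperplane orthogonal to xi when its n - 1 rows form an
   orthonormal basis of that hyperplane *)
Definition is_frame xi (B : 'M[R]_(n.-1, n)) :=
  B *m B^T = 1%:M /\ B *m xi^T = 0.

Definition frame xi : 'M[R]_(n.-1, n) := get (is_frame xi).

(* (n-1)-dimensional Lebesgue measure on the hyperplane orthogonal to xi (seen
   as a measure on R^n carried by that hyperplane): the image of Lebesgue
   measure on R^(n-1) by the linear isometry y |-> y *m frame xi. It does not
   depend on the choice of the frame, since two frames differ by an orthogonal
   transformation of R^(n-1). *)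
Definition lebesgue_orth xi : {measure set 'rV[R]_n -> \bar R} :=
  image_measure (lebesgue_rV n.-1) (measurable_mulmx (frame xi)).

End hyperplane.

Arguments sphere : clear implicits.

(* complete xi to an orthogonal matrix by a Householder reflection *)
Lemma frameP (R : realType) (n : nat) (xi : 'rV[R]_n) :
  (0 < n)%N -> sphere R n xi -> is_frame xi (frame xi).
Proof.
case: n xi => // n xi _ xi1; apply: getPex.
have {}xi1 : xi *m xi^T = 1%:M.
  by apply/matrixP => i j; rewrite !ord1 [LHS]xi1 mxE.
suff [H [HH Hxi]] : exists H : 'M[R]_(1 + n), H *m H^T = 1%:M /\ usubmx H = xi.
  exists (dsubmx H); move: HH; rewrite -[H]vsubmxK Hxi tr_col_mx mul_col_row.
  by rewrite scalar_mx_block => /eq_block_mx[_ _ Bxi BB]; rewrite col_mxKd.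
pose e : 'rV[R]_(1 + n) := delta_mx 0 0.
have ee : e *m e^T = 1%:M.
  rewrite trmx_delta mul_delta_mx; apply/matrixP => i j.
  by rewrite !ord1 !mxE !eqxx.
have eH (H : 'M[R]_(1 + n)) : usubmx H = e *m H.
  rewrite -rowE; apply/rowP => j; rewrite !mxE; congr (H _ _).
  by apply: val_inj.
have [->|xie] := eqVneq xi e.
  by exists 1%:M; rewrite trmx1 mulmx1 eH mulmx1.
pose w : 'rV[R]_(1 + n) := xi - e.
pose c : R := (e *m xi^T) 0 0.
have exi : e *m xi^T = c%:M by rewrite [LHS]mx11_scalar.
have xie' : xi *m e^T = c%:M.
  by rewrite -[LHS]trmxK trmx_mul trmxK exi tr_scalar_mx.
have ww : w *m w^T = (2 * (1 - c))%:M.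
  rewrite /w linearB /= mulmxBl !mulmxBr xi1 ee exi xie'.
  by apply/matrixP => i j; rewrite !ord1 !mxE /=; ring.
have ew : e *m w^T = (c - 1)%:M.
  rewrite /w linearB /= mulmxBr ee exi.
  by apply/matrixP => i j; rewrite !ord1 !mxE /=; ring.
have c1 : 1 - c != 0.
  apply: contraNneq xie => c1; rewrite -subr_eq0 -/w; apply/eqP/rowP => j.
  have : (w *m w^T) 0 0 = 0 by rewrite ww c1 mulr0 mxE.
  rewrite mxE => /eqP; rewrite psumr_eq0; last first.
    by move=> k _; rewrite [w^T _ _]mxE -expr2 sqr_ge0.
  move=> /allP/(_ j); rewrite mem_index_enum => /(_ isT).
  by rewrite /= [w^T _ _]mxE -expr2 sqrf_eq0 [RHS]mxE => /eqP.
have [S SE] : {S : 'M[R]_(1 + n) | S = w^T *m w} by exists (w^T *m w).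
have SS : S *m S = (2 * (1 - c)) *: S.
  by rewrite SE mulmxA -(mulmxA w^T) ww mul_mx_scalar -scalemxAl.
pose H : 'M[R]_(1 + n) := 1%:M - (1 - c)^-1 *: S.
have HT : H^T = H.
  by rewrite /H linearB /= linearZ /= trmx1 SE trmx_mul trmxK.
exists H; split.
  rewrite HT /H mulmxBl !mulmxBr !mul1mx mulmx1 -scalemxAl -scalemxAr SS !scalerA.
  rewrite (_ : _ * _ * _ = (1 - c)^-1 * 2); last by field.
  by apply/matrixP => i j; rewrite !mxE; ring.
rewrite eH /H mulmxBr mulmx1 -scalemxAr SE mulmxA ew mul_scalar_mx scalerA.
rewrite -[c - 1]opprB mulrN mulVf// scaleN1r opprK /w.
by rewrite addrC subrK.
Qed.

Section density.
Context {R : realType} {n : nat}.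
Implicit Types (K A : set 'rV[R]_n) (f : 'rV[R]_n -> R) (xi : 'rV[R]_n).

Definition convex_body K := [/\ compact K, convex_set K & K^° !=set0].

Definition origin_symmetric K := forall x, K x -> K (- x).

Definition even_fun f := forall x, f (- x) = f x.

Definition supp f : set 'rV[R]_n := closure [set x | f x != 0].

Definition probability_density f :=
  (forall x, 0 <= f x) /\ (\int[lebesgue_rV n]_x (f x)%:E = 1)%E.

Definition dmeasure f A : \bar R := (\int[lebesgue_rV n]_(x in A) (f x)%:E)%E.

Definition dmeasure_orth f xi A : \bar R :=
  (\int[lebesgue_orth xi]_(x in A `&` orth xi) (f x)%:E)%E.

End density.

(* Main.v *)
Require Import Defs.
From HB Require Import structures.
From mathcomp Require Import all_boot all_order all_algebra.
From mathcomp Require Import all_classical all_reals all_analysis.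
From mathcomp Require Import measurable_realfun gauss_integral ring lra.
Import Order.TTheory GRing.Theory Num.Theory.
Import numFieldNormedType.Exports.
Local Open Scope classical_set_scope.
Local Open Scope ring_scope.

(* Take f = k p + h + e g with k = b sqrt(n) / (2 a v), g the Gaussian
   exp(- |x|^2) and e > 0 small. On Q the density h vanishes, on U the density p
   does, so a central section of Q has measure at most b / (2 v) plus a
   contribution of e g, and a central section of U at least b / v. The Gaussian
   makes f positive, and by rotation invariance its integral over every central
   hyperplane is at most the same finite constant, so that e can be chosen
   uniformly in the direction. Finally mu_f(Q) >= k and mu_f(U) <= 2. *)

(** * A criterion for sigma-finiteness *)

(** The sets where [g] is at least 1/(k+1) exhaust the space because [g] is positive, and each has
    finite measure by Markov's inequality. Applied to a Gaussian, this gives sigma-finiteness of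
    [lebesgue_rV n], which Tonelli requires. *)
Lemma sigma_finite_ge0_integral_lty {d : measure_display} {T : measurableType d} {R : realType}
    (mu : {measure set T -> \bar R}) (g : T -> R) :
  measurable_fun setT g -> (forall x, 0 < g x) ->
  (\int[mu]_x (g x)%:E < +oo)%E -> sigma_finite setT mu.
Proof.
move=> mg g0 goo; exists (fun k => [set x | k.+1%:R^-1 <= g x]).
  apply/seteqP; split=> // x _.
  have [k] := ltr_add_invr (g0 x); rewrite add0r => /ltW kx.
  by exists k.
move=> k.
have mS : measurable [set x | k.+1%:R^-1 <= g x].
  rewrite -[X in measurable X]setTI (_ : [set x | _] = g @^-1` `[k.+1%:R^-1, +oo[).
    exact: mg.
  by apply/seteqP; split=> x; rewrite /= in_itv /= andbT.
split=> //.
have : ((k.+1%:R^-1 : R)%:E * mu [set x | k.+1%:R^-1 <= g x]%R < +oo)%E.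
  rewrite -integral_cst//; apply: le_lt_trans goo.
  apply: (@le_trans _ _ (\int[mu]_(x in [set x | k.+1%:R^-1 <= g x]%R) (g x)%:E)%E).
    apply: ge0_le_integral => //.
      by move=> x _; rewrite lee_fin invr_ge0.
    exact/measurable_EFinP/measurable_funTS.
  apply: ge0_subset_integral => //; first exact/measurable_EFinP.
  by move=> x _; rewrite lee_fin ltW.
rewrite !ltey; apply: contraNN => /eqP ->.
by rewrite gt0_muley// lte_fin invr_gt0.
Qed.

(** * The Gaussian and its symmetries *)

Lemma dotprodE {R : realType} {n : nat} (x y : 'rV[R]_n) :
  dotprod x y = \sum_i x ord0 i * y ord0 i.
Proof. by rewrite /dotprod mxE; apply: eq_bigr => i _; rewrite mxE. Qed.

Lemma continuous_dotprod {R : realType} {n : nat} (f g : 'rV[R]_n -> 'rV[R]_n) :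
  continuous f -> continuous g -> continuous (fun x => dotprod (f x) (g x)).
Proof.
move=> cf cg; under eq_fun do rewrite dotprodE.
apply: continuous_big => [|i _ x]; first exact: add_continuous.
apply: continuousM.
  by apply: (@continuous_comp _ _ _ f (fun y => y ord0 i)); [exact: cf|exact: coord_continuous].
by apply: (@continuous_comp _ _ _ g (fun y => y ord0 i)); [exact: cg|exact: coord_continuous].
Qed.

(** Left unnormalised: only positivity, finite mass and rotation invariance matter, and each
    coordinate then contributes exactly one factor [gauss_fun]. *)
Definition gauss_rV {R : realType} {n : nat} (x : 'rV[R]_n) : R :=
  expR (- dotprod x x).

Lemma continuous_gauss_rV {R : realType} {n : nat} :
  continuous (@gauss_rV R n).
Proof.
move=> x; apply: continuous_comp; last exact: continuous_expR.
by apply: continuousN; apply: continuous_dotprod => y; exact: cvg_id.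
Qed.

Lemma gauss_rV_row_mx {R : realType} {n : nat} (x : 'rV[R]_n) (t : R) :
  gauss_rV (row_mx t%:M x : 'rV[R]_n.+1) = gauss_rV x * gauss_fun t.
Proof.
rewrite /gauss_rV /gauss_fun -expRD -opprD; congr (expR (- _)).
rewrite /dotprod (@tr_row_mx _ 1 1 n) (@mul_row_col _ 1 1 n) mxE addrC.
by congr (_ + _); rewrite tr_scalar_mx -scalar_mxM mxE eqxx mulr1n.
Qed.

Lemma gauss_rV_isometry {R : realType} {m n : nat} (B : 'M[R]_(m, n))
    (y : 'rV[R]_m) :
  B *m B^T = 1%:M -> gauss_rV (y *m B) = gauss_rV y.
Proof.
by move=> BB; rewrite /gauss_rV /dotprod trmx_mul mulmxA -(mulmxA y) BB mulmx1.
Qed.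

(** * Gaussian mass of the space and of central hyperplanes *)

Lemma ge0_integral_image_measure {d1 d2 : measure_display}
    {T1 : measurableType d1} {T2 : measurableType d2} {R : realType}
    (mu : {measure set T1 -> \bar R}) (phi : T1 -> T2)
    (mphi : measurable_fun setT phi) (D : set T2) (f : T2 -> \bar R) :
  measurable D -> measurable_fun D f -> (forall y, D y -> (0 <= f y)%E) ->
  (\int[image_measure mu mphi]_(y in D) f y =
   \int[mu]_(x in phi @^-1` D) f (phi x))%E.
Proof.
move=> mD mf f0; apply: (ge0_integral_pushforward mphi _ mD mf) => y /set_mem.
exact: f0.
Qed.

Lemma integral_lebesgue_rV0 {R : realType} (f : 'rV[R]_0 -> \bar R) :
  measurable_fun setT f -> (\int[lebesgue_rV 0]_x f x = f 0%R)%E.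
Proof.
move=> mf; have := @integral_dirac _ 'rV[R]_0 0 R setT measurableT f mf.
by move=> /= ->; rewrite /dirac indicE in_setT mul1e.
Qed.

Lemma ge0_integral_lebesgue_rVS {R : realType} (n : nat) (f : 'rV[R]_n.+1 -> \bar R) :
  sigma_finite setT (@lebesgue_rV R n) ->
  measurable_fun setT f -> (forall x, 0 <= f x)%E ->
  (\int[lebesgue_rV n.+1]_x f x =
   \int[lebesgue_rV n]_x \int[lebesgue_measure]_t f (row_mx t%:M x))%E.
Proof.
move=> sf mf f0; rewrite ge0_integral_image_measure // preimage_setT.
(* Tonelli expects a bundled sigma-finite measure, so [lebesgue_rV n] is repackaged with [sf]. *)
pose m1 : {sigma_finite_measure set 'rV[R]_n -> \bar R} :=
  HB.pack_for (SigmaFiniteMeasure.type _ R) (Measure.sort (lebesgue_rV n))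
    (isSFinite.Build _ _ _ _ (sfinite_measure_sigma_finite sf))
    (isSigmaFinite.Build _ _ _ _ sf).
have := @fubini_tonelli1 _ _ _ _ R m1 (@lebesgue_measure R)
  (fun p : 'rV[R]_n * measurableTypeR R => f (row_mx (p.2 : R)%:M p.1)).
by move=> -> //; exact: (measurableT_comp mf (@measurable_row_mx R n)).
Qed.

Lemma measurable_gauss_rV {R : realType} (n : nat) :
  measurable_fun setT (EFin \o @gauss_rV R n).
Proof.
apply/measurable_EFinP; apply: continuous_measurable_rV.
exact: continuous_gauss_rV.
Qed.

(** Induction on the dimension, each coordinate contributing a factor sqrt(pi). The induction
    hypothesis serves twice: for finiteness, and for the sigma-finiteness that lets Tonelli split
    off the new coordinate. *)
Lemma integral_gauss_rV_lty {R : realType} (n : nat) :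
  (\int[lebesgue_rV n]_x (@gauss_rV R n x)%:E < +oo)%E.
Proof.
elim: n => [|n IH].
  by rewrite integral_lebesgue_rV0 ?ltry//; exact: measurable_gauss_rV.
rewrite ge0_integral_lebesgue_rVS; last 3 first.
- apply: sigma_finite_ge0_integral_lty IH => [|x]; last exact: expR_gt0.
  by apply: continuous_measurable_rV; exact: continuous_gauss_rV.
- exact: measurable_gauss_rV.
- by move=> x; rewrite lee_fin expR_ge0.
under eq_integral => x _.
  under eq_integral do rewrite gauss_rV_row_mx EFinM.
  rewrite ge0_integralZl_EFin ?expR_ge0//; last 2 first.
  - by move=> t _; rewrite lee_fin expR_ge0.
  - by apply/measurable_EFinP; exact: measurable_gauss_fun.
  rewrite integralT_gauss muleC.
  over.
rewrite ge0_integralZl_EFin ?sqrtr_ge0//=; last 2 first.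
- by move=> x _; rewrite lee_fin expR_ge0.
- exact: measurable_gauss_rV.
by apply: lte_mul_pinfty => //; rewrite lee_fin sqrtr_ge0.
Qed.

(** The rows of [frame xi] are orthonormal, so the Gaussian pulls back to the Gaussian of R^(n-1).
    The bound is thus independent of [xi]. *)
Lemma integral_orth_gauss_rV_le {R : realType} (n : nat)
    (xi : 'rV[R]_n) (A : set 'rV[R]_n) :
  (0 < n)%N -> sphere R n xi -> measurable A ->
  (\int[lebesgue_orth xi]_(x in A) (gauss_rV x)%:E <=
   \int[lebesgue_rV n.-1]_x (gauss_rV x)%:E)%E.
Proof.
move=> n0 xi1 mA; have [BB _] := frameP n0 xi1.
have g0 m (x : 'rV[R]_m) : (0 <= (gauss_rV x)%:E)%E by rewrite lee_fin expR_ge0.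
apply: (@le_trans _ _ (\int[lebesgue_orth xi]_x (gauss_rV x)%:E)%E).
  by apply: ge0_subset_integral => //; exact: measurable_gauss_rV.
rewrite ge0_integral_image_measure//; last exact: measurable_gauss_rV.
by rewrite preimage_setT; under eq_integral do rewrite gauss_rV_isometry//.
Qed.

(** * Measurable sets, supports and linearity *)

Lemma compact_measurable_rV {R : realType} {n : nat} {K : set 'rV[R]_n} :
  compact K -> measurable K.
Proof.
move=> cK; have /closed_openC oK : closed K.
  by apply: compact_closed cK; exact: norm_hausdorff.
by rewrite -[K]setCK; apply: measurableC; exact: sub_sigma_algebra.
Qed.

Lemma measurable_orth {R : realType} {n : nat} (xi : 'rV[R]_n) :
  measurable (orth xi).
Proof.
have m : measurable_fun setT (fun x => dotprod x xi).
  apply: continuous_measurable_rV.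
  by apply: (@continuous_dotprod _ _ id (cst xi)) => x; [exact: cvg_id|exact: cst_continuous].
rewrite -[X in measurable X]setTI (_ : orth xi = (dotprod^~ xi) @^-1` [set 0])//.
exact: m.
Qed.

Lemma integral_setIl_support {d : measure_display} {T : measurableType d}
    {R : realType} (mu : {measure set T -> \bar R}) (A D : set T) (f : T -> \bar R) :
  (forall x, ~ A x -> f x = 0)%E ->
  (\int[mu]_(x in A `&` D) f x = \int[mu]_(x in D) f x)%E.
Proof.
move=> fA; rewrite integral_mkcondl; apply: eq_integral => x _.
by rewrite patchE; case: ifPn => // /negP; rewrite inE => /fA.
Qed.

Lemma supp_neq0 {R : realType} {n : nat} (f : 'rV[R]_n -> R) (x : 'rV[R]_n) :
  f x != 0 -> supp f x.
Proof. by move=> fx; apply: subset_closure. Qed.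

(** Stated for an arbitrary measure so that it covers both the volume and the hyperplane
    sections. *)
Lemma ge0_integral_add3 {d : measure_display} {T : measurableType d} {R : realType}
    (mu : {measure set T -> \bar R}) (D : set T) (p h g : T -> R) (k e : R) :
  measurable D ->
  measurable_fun D p -> measurable_fun D h -> measurable_fun D g ->
  (forall x, 0 <= p x) -> (forall x, 0 <= h x) -> (forall x, 0 <= g x) ->
  0 <= k -> 0 <= e ->
  (\int[mu]_(x in D) (k * p x + h x + e * g x)%:E =
   k%:E * \int[mu]_(x in D) (p x)%:E + \int[mu]_(x in D) (h x)%:E
   + e%:E * \int[mu]_(x in D) (g x)%:E)%E.
Proof.
move=> mD mp mh mg p0 h0 g0 k0 e0.
have m (f : T -> R) : measurable_fun D f -> measurable_fun D (EFin \o f).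
  by move=> mf; apply/measurable_EFinP.
have mc c (f : T -> R) : measurable_fun D f -> measurable_fun D (fun x => c%:E * (f x)%:E)%E.
  by move=> mf; apply: (m (fun x => c * f x)); apply: measurable_funM.
have c0 c (f : T -> R) x : 0 <= c -> 0 <= f x -> (0 <= c%:E * (f x)%:E)%E.
  by move=> ? ?; rewrite -EFinM lee_fin mulr_ge0.
under eq_integral do rewrite !EFinD !EFinM.
rewrite ge0_integralD//; last 4 first.
- by move=> x _; rewrite adde_ge0 ?c0// lee_fin.
- by apply: emeasurable_funD; [exact: mc|exact: m].
- by move=> x _; rewrite c0.
- exact: mc.
rewrite ge0_integralD//; last 4 first.
- by move=> x _; rewrite c0.
- exact: mc.
- by move=> x _; rewrite lee_fin.
- exact: m.
by rewrite !ge0_integralZl_EFin//; do ?[exact: m|move=> x _; rewrite lee_fin].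
Qed.

(** * Construction of the density *)

Theorem proposition4p3 (R : realType) (a b : R) (a_gt0 : 0 < a) (b_gt0 : 0 < b) :
  exists2 c : R, 0 < c &
    forall (n : nat) (v : R) (Q U : set 'rV[R]_n),
      (2 <= n)%N ->
      1 <= v <= Num.sqrt n%:R ->
      convex_body Q -> origin_symmetric Q ->
      convex_body U -> origin_symmetric U ->
      (exists p h : 'rV[R]_n -> R,
        [/\ even_fun p, continuous p & probability_density p] /\
        [/\ even_fun h, continuous h & probability_density h] /\
        supp p `<=` Q `\` U /\
        (forall xi, sphere R n xi ->
           (\int[lebesgue_orth xi]_(x in orth xi) (p x)%:E
              <= (a / Num.sqrt n%:R)%:E)%E) /\
        supp h `<=` U `\` Q /\
        (forall xi, sphere R n xi ->
           ((b / v)%:E <= \int[lebesgue_orth xi]_(x in orth xi) (h x)%:E)%E)) ->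
      exists f : 'rV[R]_n -> R,
        [/\ even_fun f, continuous f, (forall x, 0 < f x) &
            (lebesgue_rV n).-integrable setT (EFin \o f)] /\
        (forall xi, sphere R n xi ->
           (dmeasure_orth f xi Q < dmeasure_orth f xi U)%E) /\
        c * (Num.sqrt n%:R / v) <= fine (dmeasure f Q) / fine (dmeasure f U).
Proof.
(* Half the factor b/(2a) occurring in [k] below; the other half absorbs the bound 2 on the mass of
   [U]. *)
exists (b / (4 * a)); first by rewrite divr_gt0 ?mulr_gt0.
move=> n v Q U n2 /andP[v1 _] [cQ _ _] _ [cU _ _] _ [p [h]].
move=> [[ep cp [p0 ip]] [[eh ch [h0 ih]] [pQU [pa [hUQ hb]]]]].
have n0 : (0 < n)%N by exact: leq_trans n2.
have v0 : 0 < v by exact: lt_le_trans v1.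
set s : R := Num.sqrt n%:R.
have s0 : 0 < s by rewrite sqrtr_gt0 ltr0n.
have mQ := compact_measurable_rV cQ.
have mU := compact_measurable_rV cU.
have pQ x : ~ Q x -> p x = 0.
  by move=> Qx; apply/eqP; apply: contra_notT Qx => /supp_neq0/pQU[].
have pU x : U x -> p x = 0.
  by move=> Ux; apply/eqP; apply: contraPT Ux => /supp_neq0/pQU[].
have hU x : ~ U x -> h x = 0.
  by move=> Ux; apply/eqP; apply: contra_notT Ux => /supp_neq0/hUQ[].
have hQ x : Q x -> h x = 0.
  by move=> Qx; apply/eqP; apply: contraPT Qx => /supp_neq0/hUQ[].
pose g := @gauss_rV R n.
have g0 x : 0 <= g x by exact: expR_ge0.
have [G G0 EG] : exists2 G : R, 0 <= G &
    (\int[lebesgue_rV n.-1]_x (gauss_rV x)%:E = G%:E)%E.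
  have I0 : (0 <= \int[lebesgue_rV n.-1]_x (@gauss_rV R n.-1 x)%:E)%E.
    by apply: integral_ge0 => x _; rewrite lee_fin expR_ge0.
  exists (fine (\int[lebesgue_rV n.-1]_x (@gauss_rV R n.-1 x)%:E)).
    exact: fine_ge0.
  by rewrite fineK// ge0_fin_numE// integral_gauss_rV_lty.
have gK K : measurable K -> exists2 r : R, 0 <= r &
    (\int[lebesgue_rV n]_(x in K) (g x)%:E = r%:E)%E.
  move=> mK.
  have I0 : (0 <= \int[lebesgue_rV n]_(x in K) (g x)%:E)%E.
    by apply: integral_ge0 => x _; rewrite lee_fin.
  exists (fine (\int[lebesgue_rV n]_(x in K) (g x)%:E)); first exact: fine_ge0.
  rewrite fineK// ge0_fin_numE//; apply: le_lt_trans (integral_gauss_rV_lty n).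
  apply: ge0_subset_integral => //; first exact: measurable_gauss_rV.
  by move=> x _; rewrite lee_fin.
have [gQ gQ0 EgQ] := gK _ mQ.
have [gU gU0 EgU] := gK _ mU.
(* Chosen so that [k * (a / s)] is b/(2v), half the lower bound on the sections of [h]. *)
pose k : R := b / (2 * a) * (s / v).
have k0 : 0 < k by rewrite mulr_gt0 ?divr_gt0 ?mulr_gt0.
(* The term [gU] ensures [e * gU <= 1], the last term ensures [e * G < b / (2 * v)], and the 1 makes
   the latter strict. *)
pose e : R := (1 + gU + G * (2 * v / b))^-1.
have D0 : 0 < 1 + gU + G * (2 * v / b).
  by rewrite ltr_wpDr ?ltr_wpDr// mulr_ge0// ltW// divr_gt0 ?mulr_gt0.
have e0 : 0 < e by rewrite invr_gt0.
have eG : e * G < b / (2 * v).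
  have bv : 0 < b / (2 * v) by rewrite divr_gt0 ?mulr_gt0.
  rewrite mulrC ltr_pdivrMr// mulrDr.
  have -> : b / (2 * v) * (G * (2 * v / b)) = G by field; lra.
  by rewrite ltrDr mulr_gt0// ltr_wpDr.
have eU : e * gU <= 1.
  rewrite mulrC ler_pdivrMr// mul1r -addrA addrCA lerDl addr_ge0//.
  by rewrite mulr_ge0// ltW// divr_gt0 ?mulr_gt0.
have mfun D (q : 'rV[R]_n -> R) : continuous q -> measurable_fun D q.
  by move=> cq; apply: measurable_funTS; exact: continuous_measurable_rV.
have cg : continuous g by exact: continuous_gauss_rV.
pose f x := k * p x + h x + e * g x.
have cf : continuous f.
  have cZ c (q : 'rV[R]_n -> R) : continuous q -> continuous (fun x => c * q x).
    by move=> cq x; apply: (@continuousM _ _ (cst c) q); [exact: cst_continuous|exact: cq].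
  have cD (q r : 'rV[R]_n -> R) :
      continuous q -> continuous r -> continuous (fun x => q x + r x).
    by move=> cq cr x; apply: continuousD; [exact: cq|exact: cr].
  exact: cD (cD _ _ (cZ k _ cp) ch) (cZ e _ cg).
have If (mu : {measure set 'rV[R]_n -> \bar R}) D : measurable D ->
  (\int[mu]_(x in D) (f x)%:E =
   k%:E * \int[mu]_(x in D) (p x)%:E + \int[mu]_(x in D) (h x)%:E
   + e%:E * \int[mu]_(x in D) (g x)%:E)%E.
  move=> mD; apply: ge0_integral_add3 => //; do ?exact: mfun; exact: ltW.
have f_gt0 x : 0 < f x.
  by rewrite ltr_wpDl ?mulr_gt0 ?expR_gt0// addr_ge0// mulr_ge0// ltW.
exists f; split; [split => //|split].
- by move=> x; rewrite /f ep eh /g /gauss_rV /dotprod linearN /= mulmxN mulNmx opprK.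
- apply/integrableP; split; first by apply/measurable_EFinP; exact: mfun.
  under eq_integral do rewrite /= gtr0_norm//.
  rewrite If// ip ih mule1.
  have [r _ ->] := gK _ measurableT.
  by rewrite -EFinM -!EFinD ltry.
- move=> xi xi1; have mxi := measurable_orth xi.
  rewrite /dmeasure_orth !If//; try exact: measurableI.
  (* Since [p] vanishes off [Q], its integral over the section of [Q] is the one over the whole
     hyperplane, bounded by [pa]; [h] contributes nothing there. *)
  rewrite [X in (_ * X + _ + _ < _)%E](@integral_setIl_support _ _ _ _ Q) =>
    [|x /pQ -> //].
  rewrite (@integral0_eq _ _ _ _ _ (fun x => (h x)%:E)) => [|x [/hQ ->]//].
  rewrite adde0.
  rewrite [X in (_ < _ + X + _)%E](@integral_setIl_support _ _ _ _ U) =>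
    [|x /hU -> //].
  (* The value b/v separates the two sections: the one of [Q] is at most b/(2v) + [e * G], while the
     [h] term alone brings the one of [U] to b/v. *)
  apply: (@lt_le_trans _ _ (b / v)%:E).
    apply: (@le_lt_trans _ _ (k%:E * (a / s)%:E + e%:E * G%:E)%E).
      apply: leeD; apply: lee_wpmul2l; try by rewrite lee_fin ltW.
        exact: pa.
      by rewrite -EG; apply: integral_orth_gauss_rV_le => //; exact: measurableI.
    rewrite -!EFinM -EFinD lte_fin.
    have -> : k * (a / s) = b / (2 * v) by rewrite /k; field; lra.
    have -> : b / v = b / (2 * v) + b / (2 * v) by field; lra.
    by rewrite ltrD2l.
  apply: (le_trans (hb _ xi1)).
  rewrite [X in (_ <= X + _)%E]addeC -addeA leeDl//.
  by apply: adde_ge0; apply: mule_ge0; rewrite ?lee_fin ?(ltW k0) ?(ltW e0)//;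
    apply: integral_ge0 => x _; rewrite lee_fin.
(* All the mass of [p] lies in [Q] and all that of [h] in [U], so both masses are explicit up to the
   Gaussian terms. *)
- have -> : fine (dmeasure f Q) = k + e * gQ.
    rewrite /dmeasure If// EgQ (@integral0_eq _ _ _ _ _ (fun x => (h x)%:E)) => [|x /hQ ->//].
    rewrite -[X in (_ * \int[_]_(x in X) _ + _ + _)%E]setIT.
    by rewrite integral_setIl_support ?ip ?mule1 ?adde0// => x /pQ ->.
  have -> : fine (dmeasure f U) = 1 + e * gU.
    rewrite /dmeasure If// EgU (@integral0_eq _ _ _ _ _ (fun x => (p x)%:E)) => [|x /pU ->//].
    rewrite mule0 add0e -[X in (\int[_]_(x in X) _ + _)%E]setIT.
    by rewrite integral_setIl_support ?ih// => x /hU ->.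
  have eU0 : 0 <= e * gU by rewrite mulr_ge0// ltW.
  have eQ0 : 0 <= e * gQ by rewrite mulr_ge0// ltW.
  rewrite ler_pdivlMr; last by rewrite ltr_wpDr.
  have -> : b / (4 * a) * (s / v) = k / 2 by rewrite /k; field; lra.
  (* By [eU] and [eQ0], k/2 times (1 + [e * gU]) is at most [k], hence at most [k + e * gQ]. *)
  nra.
Qed.
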